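(* Let $A\in\mathbb{R}^{m\times n}$, and let $\Sigma_{x^\dagger}\in\mathbb{R}^{n\times n}$ and $\Sigma_\varepsilon\in\mathbb{R}^{m\times m}$ be symmetric positive semidefinite matrices (the covariances of the data $x^\dagger$ and of the noise $\varepsilon$), with $A^TA$ and $\Sigma_{x^\dagger}$ invertible. Assume that the matrices $\big(A^TA+A^T\Sigma_\varepsilon A(A^TA)^{-1}\Sigma_{x^\dagger}^{-1}\big)^{-1}$ and $(A\Sigma_{x^\dagger}A^T+\Sigma_\varepsilon)^{-1}$ exist. Then the following are equivalent: 1. The best linear map for Lavrentiev regularization $$W_{\mathrm{Lav}}:=\big(A^TA+A^T\Sigma_\varepsilon A(A^TA)^{-1}\Sigma_{x^\dagger}^{-1}\big)^{-1}A^T$$ is equal to the linear map from the LMMSE estimator $$W_{\mathrm{LMMSE}}:=\Sigma_{x^\dagger}A^T(A\Sigma_{x^\dagger}A^T+\Sigma_\varepsilon)^{-1}.$$ 2. The noise covariance $\Sigma_\varepsilon$ leaves the kernel of $A^T$ invariant, i.e. $A^T\Sigma_\varepsilon P_{\ker(A^T)}=0$.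
   Context: $P_{\ker(A^T)}\in\mathbb{R}^{m\times m}$ denotes the orthogonal projection onto the kernel of $A^T$. ''$\Sigma_\varepsilon$ leaves $\ker(A^T)$ invariant'' means $\Sigma_\varepsilon\ker(A^T)\subseteq\ker(A^T)$. *)

(* Defs.v *)
From mathcomp Require Import all_boot all_order all_algebra.
From mathcomp Require Import reals.

Set Implicit Arguments.
Unset Strict Implicit.
Unset Printing Implicit Defensive.

Import Order.TTheory GRing.Theory Num.Theory.
Local Open Scope ring_scope.

Definition psdmx (R : realType) (n : nat) (S : 'M[R]_n) : Prop :=
  S \is symmetricmx /\ forall v : 'cV[R]_n, 0 <= (v^T *m S *m v) 0 0.

(* [M] acts on column vectors, so its kernel is the transpose of the row space
   of [kermx M^T]; the second argument of [proj_mx] is the orthogonal complement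
   of that row space. The outer transpose is there because [proj_mx] acts on row
   vectors from the right. See [orthproj_kerP]. *)
Definition orthproj_ker (R : realType) (p q : nat) (M : 'M[R]_(p, q)) :
    'M[R]_q :=
  (proj_mx (kermx M^T) (kermx (kermx M^T)^T))^T.

Definition leaves_ker_invariant (R : realType) (p q : nat)
    (S : 'M[R]_q) (M : 'M[R]_(p, q)) : Prop :=
  forall v : 'cV[R]_q, M *m v = 0 -> M *m (S *m v) = 0.

Definition W_Lav (R : realType) (m n : nat)
    (A : 'M[R]_(m, n)) (Sx : 'M[R]_n) (Se : 'M[R]_m) : 'M[R]_(n, m) :=
  invmx (A^T *m A + A^T *m Se *m A *m invmx (A^T *m A) *m invmx Sx) *m A^T.

Definition W_LMMSE (R : realType) (m n : nat)
    (A : 'M[R]_(m, n)) (Sx : 'M[R]_n) (Se : 'M[R]_m) : 'M[R]_(n, m) :=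
  Sx *m A^T *m invmx (A *m Sx *m A^T + Se).

Lemma rV_sqr_eq0 (R : realType) (n : nat) (u : 'rV[R]_n) :
  u *m u^T = 0 -> u = 0.
Proof.
move=> /matrixP /(_ 0 0); rewrite !mxE => /eqP.
rewrite psumr_eq0; last by move=> i _; rewrite mxE -expr2 sqr_ge0.
move=> /allP u0; apply/rowP => i; rewrite mxE.
by have := u0 i (mem_index_enum i); rewrite mxE -expr2 sqrf_eq0 => /eqP.
Qed.

Lemma cap_ker_ortho (R : realType) (p n : nat) (U : 'M[R]_(p, n)) :
  (U :&: kermx U^T)%MS = 0.
Proof.
apply/eqP/rowV0P => u; rewrite sub_capmx => /andP[/submxP[D uE] /sub_kermxP u0].
by apply: rV_sqr_eq0; rewrite {2}uE trmx_mul mulmxA u0 mul0mx.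
Qed.

(* The two conditions determine [orthproj_ker M *m v] uniquely. *)
Lemma orthproj_kerP (R : realType) (p q : nat) (M : 'M[R]_(p, q))
    (v : 'cV[R]_q) :
  M *m (orthproj_ker M *m v) = 0 /\
  forall w : 'cV[R]_q, M *m w = 0 -> w^T *m (v - orthproj_ker M *m v) = 0.
Proof.
rewrite /orthproj_ker; set U := kermx M^T; set V := kermx U^T.
have vUV : (v^T <= U + V)%MS.
  suff /submx_full : row_full (U + V)%MS by apply.
  have := mxrank_sum_cap U V.
  have rV : \rank V = (q - \rank U)%N by rewrite mxrank_ker mxrank_tr.
  rewrite cap_ker_ortho mxrank0 addn0 rV => rE.
  by rewrite /row_full rE subnKC ?rank_leq_row.
split.
  have /sub_kermxP/(congr1 trmx) := proj_mx_sub U V v^T.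
  by rewrite !trmx_mul !trmxK trmx0.
move=> w Mw0; have /submxP[D wE] : (w^T <= U)%MS.
  by apply/sub_kermxP; rewrite -trmx_mul Mw0 trmx0.
have /sub_kermxP/(congr1 trmx) := proj_mx_compl_sub vUV.
rewrite trmx_mul trmxK trmx0 linearB /= trmx_mul !trmxK => E.
by rewrite wE -mulmxA E mulmx0.
Qed.

(* Main.v *)
Require Import Defs.
From mathcomp Require Import all_boot all_order all_algebra.
From mathcomp Require Import reals.

Set Implicit Arguments.
Unset Strict Implicit.
Unset Printing Implicit Defensive.

Import Order.TTheory GRing.Theory Num.Theory.
Local Open Scope ring_scope.

(** Clearing the two inverses turns the equality of the estimators into
    A^T (A Sx A^T + Se) = (A^T A + A^T Se A (A^T A)^-1 Sx^-1) Sx A^T.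
    The terms A^T A Sx A^T cancel, and what is left is A^T Se Q = 0, where
    Q = 1 - A (A^T A)^-1 A^T. Now Q is a projection onto the kernel of A^T, and
    for every projection onto that kernel the equation A^T Se Q = 0 says exactly
    that Se leaves the kernel invariant ([leaves_ker_invariant_proj]). Using this
    twice, for Q and for [orthproj_ker A^T], gives both equivalences. *)

Lemma mulmx_delta_eq0 (R : nzSemiRingType) (p q : nat) (B : 'M[R]_(p, q)) :
  (forall j, B *m delta_mx j 0 = 0 :> 'cV[R]_p) -> B = 0.
Proof.
move=> B0; apply/matrixP => i j; rewrite mxE.
by have /colP/(_ i) := B0 j; rewrite -colE !mxE.
Qed.

(** The complement along which [Q] projects is arbitrary, so that [orthproj_ker]
    and the closed formula of [ker_tr_projmx] both qualify with no need to
    identify them. *)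
Definition ker_projmx (R : nzRingType) (p q : nat) (M : 'M[R]_(p, q))
    (Q : 'M[R]_q) : Prop :=
  M *m Q = 0 /\ forall v : 'cV[R]_q, M *m v = 0 -> Q *m v = v.

(** The range of [Q] is the whole kernel, so testing [M *m S] on the columns of
    [Q] is the same as testing it on every vector of the kernel. *)
Lemma leaves_ker_invariant_proj (R : realType) (p q : nat)
    (S : 'M[R]_q) (M : 'M[R]_(p, q)) (Q : 'M[R]_q) :
  ker_projmx M Q -> (leaves_ker_invariant S M <-> M *m S *m Q = 0).
Proof.
move=> [MQ0 Qid]; split=> [inv | MSQ0 v Mv0]; last first.
  by rewrite -(Qid v Mv0) !mulmxA MSQ0 mul0mx.
apply: mulmx_delta_eq0 => j; rewrite -!mulmxA inv //.
by rewrite mulmxA MQ0 mul0mx.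
Qed.

(** The residual of a kernel vector under the orthogonal projection is in the
    kernel, hence orthogonal to itself, hence zero. *)
Lemma orthproj_ker_projmx (R : realType) (p q : nat) (M : 'M[R]_(p, q)) :
  ker_projmx M (orthproj_ker M).
Proof.
split=> [|v Mv0].
  apply: mulmx_delta_eq0 => j.
  by rewrite -mulmxA (orthproj_kerP M (delta_mx j 0)).1.
have [MPv0 orth] := orthproj_kerP M v.
have Mr0 : M *m (v - orthproj_ker M *m v) = 0 by rewrite mulmxBr Mv0 MPv0 subr0.
apply/esym/subr0_eq/trmx_inj; rewrite trmx0.
by apply: rV_sqr_eq0; rewrite trmxK orth.
Qed.

Lemma ker_tr_projmx (R : comUnitRingType) (m n : nat) (A : 'M[R]_(m, n)) :
  A^T *m A \in unitmx ->
  ker_projmx A^T (1%:M - A *m invmx (A^T *m A) *m A^T).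
Proof.
move=> uG; split=> [|v Av0].
  by rewrite mulmxBr mulmx1 !mulmxA mulmxV // mul1mx subrr.
by rewrite mulmxBl mul1mx -!mulmxA Av0 !mulmx0 subr0.
Qed.

Lemma eq_invmx_mul (R : comUnitRingType) (m n : nat) (L : 'M[R]_n)
    (K : 'M[R]_m) (X Y : 'M[R]_(n, m)) :
  L \in unitmx -> K \in unitmx ->
  (invmx L *m X = Y *m invmx K <-> X *m K = L *m Y).
Proof.
move=> uL uK; split=> [E | E].
  by rewrite -[X](mulKVmx uL) E -!mulmxA mulVmx // mulmx1.
by rewrite -[X](mulmxK uK) E !mulmxA mulVmx // mul1mx.
Qed.

Theorem theorem6p1 (R : realType) (m n : nat)
    (A : 'M[R]_(m, n)) (Sx : 'M[R]_n) (Se : 'M[R]_m)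
    (psd_Sx : psdmx Sx) (psd_Se : psdmx Se)
    (unit_AtA : A^T *m A \in unitmx)
    (unit_Sx : Sx \in unitmx)
    (unit_Lav : A^T *m A + A^T *m Se *m A *m invmx (A^T *m A) *m invmx Sx
                \in unitmx)
    (unit_LMMSE : A *m Sx *m A^T + Se \in unitmx) :
  (W_Lav A Sx Se = W_LMMSE A Sx Se <-> leaves_ker_invariant Se A^T) /\
  (leaves_ker_invariant Se A^T <-> A^T *m Se *m orthproj_ker A^T = 0).
Proof.
split; last exact/leaves_ker_invariant_proj/orthproj_ker_projmx.
have [toQ ofQ] := leaves_ker_invariant_proj Se (ker_tr_projmx unit_AtA).
have [clear unclear] :=
  eq_invmx_mul A^T (Sx *m A^T) unit_Lav unit_LMMSE.
set Q := 1%:M - _ in toQ ofQ.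
have gap : A^T *m (A *m Sx *m A^T + Se) -
    (A^T *m A + A^T *m Se *m A *m invmx (A^T *m A) *m invmx Sx) *m (Sx *m A^T)
    = A^T *m Se *m Q.
  rewrite /Q mulmxBr mulmx1 mulmxDr mulmxDl !mulmxA mulmxKV //.
  by rewrite opprD addrACA subrr add0r.
rewrite /W_Lav /W_LMMSE; split=> [/clear E | /toQ Q0].
  by apply: ofQ; rewrite -gap E subrr.
by apply/unclear/subr0_eq; rewrite gap.
Qed.
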